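(* Let $\Gamma$ be an $n$-player game ($n\ge 2$) with finite nonempty pure strategy sets $S_1,\dots,S_n$ and payoff functions $A_1,\dots,A_n$. A mixed strategy profile $(\mathbf{x}^1,\dots,\mathbf{x}^n)$ is a (mixed) Nash equilibrium of $\Gamma$ if and only if there exist real numbers $p^1,\dots,p^n$ such that $(\mathbf{x}^1,\dots,\mathbf{x}^n,p^1,\dots,p^n)$ is an optimal solution (global maximizer) of the optimization problem $$\max_{\mathbf{x},\mathbf{p}}\ \sum_{i=1}^n\Big(\sum_{(s,\hat{\mathbf{s}})\in S_i\times S_{-i}} A_i[s,\hat{\mathbf{s}}]\,x^i_s\prod_{s_j\in\hat{\mathbf{s}}}x^j_{s_j}\Big)-\sum_{i=1}^n p^i$$ subject to $$\sum_{\hat{\mathbf{s}}\in S_{-i}}A_i[s,\hat{\mathbf{s}}]\prod_{s_j\in\hat{\mathbf{s}}}x^j_{s_j}\le p^i\quad\forall i\in[n],\ s\in S_i,$$ $$\sum_{s\in S_i}x^i_s=1\quad\forall i\in[n],\qquad 0\le x^i_s\le 1\quad\forall i\in[n],\ s\in S_i,$$ where the variables are $x^i_s\in\mathbb{R}$ ($i\in[n]$, $s\in S_i$) and $p^i\in\mathbb{R}$ ($i\in[n]$).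
   Context: Let $[n]=\{1,\dots,n\}$ be the set of players. Player $i$ has a finite nonempty set $S_i$ of pure strategies. $S_{-i}=S_1\times\dots\times S_{i-1}\times S_{i+1}\times\dots\times S_n$ is the set of pure strategy tuples of all players other than $i$. The payoff function of player $i$ is $A_i:S_1\times\dots\times S_n\to\mathbb{R}$; for $s\in S_i$ and $\hat{\mathbf{s}}\in S_{-i}$, $A_i[s,\hat{\mathbf{s}}]$ is the payoff of player $i$ when $i$ plays $s$ and the others play $\hat{\mathbf{s}}$. For $\hat{\mathbf{s}}=(s_j)_{j\ne i}\in S_{-i}$, the notation $\prod_{s_j\in\hat{\mathbf{s}}}x^j_{s_j}$ means $\prod_{j\ne i}x^j_{s_j}$. A mixed strategy of player $i$ is a vector $\mathbf{x}^i=(x^i_s)_{s\in S_i}$ with $x^i_s\ge 0$ and $\sum_{s\in S_i}x^i_s=1$ (pure strategies are special cases). A mixed strategy profile is a tuple $\mathbf{x}=(\mathbf{x}^1,\dots,\mathbf{x}^n)$ of mixed strategies; player $i$'s expected payoff is $\mathbb{E}[A_i[\mathbf{x}]]=\sum_{s\in S_i}x^i_s\sum_{\hat{\mathbf{s}}\in S_{-i}}A_i[s,\hat{\mathbf{s}}]\prod_{s_j\in\hat{\mathbf{s}}}x^j_{s_j}$. A profile $\mathbf{x}$ is a (mixed) Nash equilibrium if for every player $i$ and every mixed strategy $\mathbf{y}^i$ of player $i$, $\mathbb{E}[A_i[\mathbf{x}]]\ge\mathbb{E}[A_i[\mathbf{y}^i,\mathbf{x}^{-i}]]$, where $(\mathbf{y}^i,\mathbf{x}^{-i})$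 is $\mathbf{x}$ with $\mathbf{x}^i$ replaced by $\mathbf{y}^i$. *)

(* Defs.v *)
(* The real numbers are modelled by an arbitrary R : realType. *)
From mathcomp Require Import all_boot all_order all_algebra.
From mathcomp Require Import reals.

Set Implicit Arguments.
Unset Strict Implicit.
Unset Printing Implicit Defensive.

Import Order.TTheory GRing.Theory Num.Theory.
Local Open Scope ring_scope.

Section Game.
Variables (R : realType) (n : nat) (S : 'I_n -> finType).

Definition pure_profile : Type := {dffun forall j : 'I_n, S j}.

(* [opp_profile i] is S_{-i}. Both are notations, so that their finType
   structures are inferred. *)
Local Notation others i := {j : 'I_n | j != i}.
Local Notation opp_profile i := {dffun forall j : others i, S (val j)}.

(* The pure profile (s, t) in which i plays s and the others play t. *)
Definition join_profile (i : 'I_n) (s : S i) (t : opp_profile i) :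
    pure_profile :=
  [ffun j : 'I_n =>
     match eqVneq j i with
     | EqNotNeq e => ecast k (S k) (esym e) s
     | NeqNotEq ne => t (exist _ j ne)
     end].

Lemma join_profile_own (i : 'I_n) (s : S i) (t : opp_profile i) :
  join_profile s t i = s.
Proof. by rewrite ffunE; case: eqVneq => [e|/eqP//]; rewrite eq_axiomK. Qed.

Lemma join_profile_other (i : 'I_n) (s : S i) (t : opp_profile i)
    (j : others i) : join_profile s t (val j) = t j.
Proof.
rewrite ffunE; case: j => j nji /=; case: eqVneq => [e|ne].
  by case/eqP: (nji).
by rewrite (bool_irrelevance ne nji).
Qed.

(* An arbitrary family of real vectors x^i; only [mixed_profile] imposes the
   simplex constraints. *)
Definition vec_profile : Type := forall i : 'I_n, S i -> R.

Definition mixed_strategy (i : 'I_n) (z : S i -> R) : Prop :=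
  (forall s : S i, 0 <= z s) /\ \sum_(s : S i) z s = 1.

Definition mixed_profile (x : vec_profile) : Prop :=
  forall i : 'I_n, mixed_strategy (x i).

Variable A : 'I_n -> pure_profile -> R.

(* Payoff of i from the pure strategy s against x^{-i}; it does not depend
   on x i. *)
Definition pure_payoff (x : vec_profile) (i : 'I_n) (s : S i) : R :=
  \sum_(t : opp_profile i)
     A i (join_profile s t) * \prod_(j : others i) x (val j) (t j).

Definition expected_payoff (x : vec_profile) (i : 'I_n) : R :=
  \sum_(s : S i) x i s * pure_payoff x s.

(* [dfwith x y] is (y, x^{-i}) for y : S i -> R. To be applied to mixed
   profiles x only. *)
Definition nash_equilibrium (x : vec_profile) : Prop :=
  forall (i : 'I_n) (y : S i -> R), mixed_strategy y ->
    expected_payoff (dfwith x y) i <= expected_payoff x i.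

Definition objective (x : vec_profile) (p : 'I_n -> R) : R :=
  \sum_(i < n)
     (\sum_(u : S i * opp_profile i)
        A i (join_profile u.1 u.2) * x i u.1 *
        \prod_(j : others i) x (val j) (u.2 j))
  - \sum_(i < n) p i.

Definition feasible (x : vec_profile) (p : 'I_n -> R) : Prop :=
  [/\ forall (i : 'I_n) (s : S i), pure_payoff x s <= p i,
      forall i : 'I_n, \sum_(s : S i) x i s = 1 &
      forall (i : 'I_n) (s : S i), 0 <= x i s <= 1].

Definition optimal_solution (x : vec_profile) (p : 'I_n -> R) : Prop :=
  feasible x p /\
  forall (y : vec_profile) (q : 'I_n -> R),
    feasible y q -> objective y q <= objective x p.

End Game.

(* Main.v *)
(* Every feasible point has objective at most 0, and a Nash equilibrium, with
   p^i its expected payoffs, reaches 0. Conversely, a maximizer of value 0 is an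
   equilibrium, so it remains to see that the supremum is 0; for this,
   approximate equilibria are enough, and no compactness is needed.
   These come from Scarf's combinatorial lemma on a grid of the simplex of
   vectors z whose coordinates are indexed by all pairs (i, s) of a player and
   one of its strategies. Label z by a pair (i, s) such that i has mass at most 1/n and s
   is a best reply of i to n z (the payoffs, being multilinear, make sense for
   vectors that are not normalized). A small fully labelled cell gives a z such
   that each coordinate (i, s) is either almost 0 or the label of a nearby
   point. Then each player has mass almost at most, hence almost exactly, 1/n,
   and puts almost all of it on almost best replies. *)
Require Import Defs.
From mathcomp Require Import all_boot all_order all_algebra.
From mathcomp Require Import reals.
From mathcomp Require Import zify ring lra.

Set Implicit Arguments.
Unset Strict Implicit.
Unset Printing Implicit Defensive.

Import Order.TTheory GRing.Theory Num.Theory.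

(** * Scarf's lemma *)

Section Dominance.
Variables (Y I : finType) (rk : I -> Y -> nat).
Hypothesis rk_inj : forall j, injective (rk j).
Implicit Types (U V : {set Y}) (i j k l : I) (y z : Y).

(** For nonempty U: no point lies above the minimum of U in every order at once. Those with #|I|
    elements, the rooms below, are Scarf's primitive sets. *)
Definition dominant U := [forall y, exists j, forall u in U, rk j y <= rk j u].

Lemma dominantP U :
  reflect (forall y, exists j, forall u, u \in U -> rk j y <= rk j u)
          (dominant U).
Proof.
apply: (iffP forallP) => domU y.
  by have /existsP[j /forall_inP] := domU y; exists j.
by have [j Hj] := domU y; apply/existsP; exists j; apply/forall_inP.
Qed.

Lemma dominantS U V : V \subset U -> dominant U -> dominant V.
Proof.
move=> /subsetP sVU /dominantP domU; apply/dominantP => y.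
by have [j Hj] := domU y; exists j => u /sVU /Hj.
Qed.

Definition is_min U j y := (y \in U) && [forall u in U, rk j y <= rk j u].

Lemma is_minP U j y :
  reflect (y \in U /\ forall u, u \in U -> rk j y <= rk j u) (is_min U j y).
Proof. by apply: (iffP andP) => -[? /forall_inP]. Qed.

Lemma is_min_uniq U j y z : is_min U j y -> is_min U j z -> y = z.
Proof.
move=> /is_minP[yU miny] /is_minP[zU minz]; apply: (rk_inj (j := j)).
by apply/eqP; rewrite eqn_leq miny ?minz.
Qed.

Lemma min_exists U : U != set0 -> {m : I -> Y | forall j, is_min U j (m j)}.
Proof.
move=> /set0Pn/sigW[y0 y0U].
exists (fun j => [arg min_(y < y0 in U) rk j y]) => j.
by case: arg_minnP => // y yU miny; apply/is_minP.
Qed.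

Lemma dominant_min U y : dominant U -> y \in U -> exists j, is_min U j y.
Proof. by move=> /dominantP/(_ y)[j Hj] yU; exists j; apply/is_minP. Qed.

(** By dominance every element of U is the minimum for some index, so indices map onto U; equal
    cardinalities make this map injective. *)
Lemma dominant_min_inj U y i j :
  dominant U -> #|U| = #|I| -> is_min U i y -> is_min U j y -> i = j.
Proof.
move=> domU cU mi mj.
have U0 : U != set0 by apply/set0Pn; exists y; case/is_minP: mi.
have [m mP] := min_exists U0.
have imU : m @: setT = U.
  apply/setP => z; apply/imsetP/idP => [[k _ ->]|zU].
    by case/is_minP: (mP k).
  have [k mk] := dominant_min domU zU; exists k => //.
  exact: is_min_uniq mk (mP k).
have /imset_injP inj : #|m @: setT| == #|[set: I]| by rewrite imU cardsT cU.
by apply: inj; rewrite ?inE // (is_min_uniq (mP i) mi) (is_min_uniq (mP j) mj).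
Qed.

(** * Doors: dominant sets with one element missing *)

Section Door.
Variables (V : {set Y}) (m : I -> Y).
Hypotheses (domV : dominant V) (cV : #|V|.+1 = #|I|).
Hypothesis mP : forall j, is_min V j (m j).

Let minV j u : u \in V -> rk j (m j) <= rk j u.
Proof. by case/is_minP: (mP j) => _; apply. Qed.

(* The points that can replace the minimum of V for k without changing the
   other minima; the topmost of them yields the room over V in which the new
   point is the minimum for k. *)
Definition above k y := [forall (l | l != k), rk l (m l) < rk l y].

Definition top k y := above k y && [forall (z | above k z), rk k z <= rk k y].

Lemma top_uniq k y z : top k y -> top k z -> y = z.
Proof.
move=> /andP[ay /forall_inP ty] /andP[az /forall_inP tz].
by apply: (rk_inj (j := k)); apply/eqP; rewrite eqn_leq ty ?tz.
Qed.

Lemma top_exists k y : above k y -> exists z, top k z.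
Proof.
move=> ay; exists [arg max_(z > y | above k z) rk k z].
by case: arg_maxnP => // z az tz; apply/andP; split=> //; apply/forall_inP.
Qed.

Lemma min_collision : exists i j, i != j /\ m i = m j.
Proof.
have /injectivePn[i [j nij mij]] : ~~ injectiveb m; last by exists i, j.
apply/injectiveP => minj; have := card_codom minj.
have /subset_leq_card : codom m \subset V.
  by apply/subsetP => _ /codomP[k ->]; case/is_minP: (mP k).
by move=> + cE; rewrite cE -cV ltnn.
Qed.

Variables (i j : I).
Hypotheses (nij : i != j) (mij : m i = m j).

Lemma not_above_both y : above i y -> above j y -> False.
Proof.
move=> /forall_inP ai /forall_inP aj; have /dominantP/(_ y)[k Hk] := domV.
have := Hk _ (proj1 (is_minP _ _ _ (mP k))).
by rewrite leqNgt; case: (eqVneq k i) => [->|/ai->//]; rewrite aj.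
Qed.

(** Dominance of V at y can only be witnessed by k, so y is the new minimum there. A point above for
    k is bounded by y, by maximality; any other fails at some l other than k, whose minimum is still
    [m l]. The shared minimum [m k = m k'] keeps y out of V. *)
Lemma top_dominant k k' y : k != k' -> m k = m k' -> top k y ->
  y \notin V /\ dominant (y |: V).
Proof.
move=> nkk' mkk' /andP[/forall_inP ay /forall_inP ty].
have yk : rk k y <= rk k (m k).
  have /dominantP/(_ y)[l Hl] := domV.
  have [<-|nlk] := eqVneq l k; first exact: Hl (proj1 (is_minP _ _ _ (mP l))).
  by have := ay _ nlk; rewrite ltnNge Hl //; case/is_minP: (mP l).
have yNm : y != m k.
  by apply/eqP => yE; have := ay k'; rewrite -mkk' -yE ltnn eq_sym => /(_ nkk').
split.
  apply: contra yNm => yV; apply/eqP/(rk_inj (j := k))/eqP.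
  by rewrite eqn_leq yk minV.
apply/dominantP => z; case: (boolP (above k z)) => [az|].
  exists k => u; rewrite !inE => /predU1P[->|uV]; first exact: ty.
  exact: leq_trans (ty _ az) (leq_trans yk (minV _ uV)).
rewrite negb_forall => /existsP[l]; rewrite negb_imply -leqNgt => /andP[nlk zl].
exists l => u; rewrite !inE => /predU1P[->|uV].
  exact: leq_trans zl (ltnW (ay _ nlk)).
exact: leq_trans zl (minV _ uV).
Qed.

(** The new point is the minimum of the room for some k, and the other indices keep their minima.
    These are distinct in a room, so k must be one of the two colliding indices. *)
Lemma dominant_top y : y \notin V -> dominant (y |: V) -> top i y \/ top j y.
Proof.
move=> yV domU; have cU : #|y |: V| = #|I| by rewrite cardsU1 yV -cV.
have yU : y \in y |: V by rewrite setU11.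
have [k mk] := dominant_min domU yU.
have ay l : l != k -> rk l (m l) < rk l y.
  move=> nlk; rewrite ltnNge; apply: contra nlk => yl; apply/eqP.
  apply: (dominant_min_inj domU cU) mk; apply/is_minP; split=> // u.
  rewrite !inE => /predU1P[->//|uV]; exact: leq_trans yl (minV _ uV).
have minU l : l != k -> is_min (y |: V) l (m l).
  move=> nlk; apply/is_minP; split.
    by rewrite !inE (proj1 (is_minP _ _ _ (mP l))) orbT.
  by move=> u; rewrite !inE => /predU1P[->|/minV//]; apply/ltnW/ay.
have topk : top k y.
  apply/andP; split; first exact/forall_inP.
  apply/forall_inP => z /forall_inP az; have /dominantP/(_ z)[l Hl] := domU.
  have [<-|nlk] := eqVneq l k; first exact: Hl.
  have := az _ nlk; rewrite ltnNge Hl // !inE.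
  by rewrite (proj1 (is_minP _ _ _ (mP l))) orbT.
have [<-|ik] := eqVneq k i; first by left.
have [<-|jk] := eqVneq k j; first by right.
case/eqP: nij; apply: (dominant_min_inj domU cU (y := m i)).
  by apply: minU; rewrite eq_sym.
by rewrite mij; apply: minU; rewrite eq_sym.
Qed.

End Door.

Definition rooms V :=
  [set U : {set Y} | [&& V \subset U, #|U| == #|I| & dominant U]].

(** The rooms over V arise by adding the top point for i or for j. The two points differ when both
    exist, and each exists as soon as there is a candidate. *)
Lemma odd_rooms V m i j : dominant V -> #|V|.+1 = #|I| ->
    (forall k, is_min V k (m k)) -> i != j -> m i = m j ->
  odd #|rooms V| =
    [exists y, above m i y] (+) [exists y, above m j y].
Proof.
move=> domV cV mP nij mij.
have roomP U : U \in rooms V ->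
    exists y, [/\ U = y |: V, y \notin V & top m i y \/ top m j y].
  rewrite inE => /and3P[sVU /eqP cU domU].
  have /eqP/cards1P[y Uy] : #|U :\: V| = 1.
    by rewrite cardsD (setIidPr sVU) cU -cV subSnn.
  have UE : U = y |: V by rewrite -Uy setUC -{1}(setID U V) (setIidPr sVU).
  have yV : y \notin V by have := set11 y; rewrite -Uy inE => /andP[].
  by exists y; split=> //; apply: (dominant_top cV mP nij mij); rewrite -?UE.
have top_room k k' y : k != k' -> m k = m k' -> top m k y -> y |: V \in rooms V.
  move=> nk mk ty; have [yV domU] := top_dominant domV mP nk mk ty.
  by rewrite inE subsetUr domU cardsU1 yV -cV eqxx.
have topV k k' y : k != k' -> m k = m k' -> top m k y -> y \notin V.
  by move=> nk mk ty; have [] := top_dominant domV mP nk mk ty.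
have setU1V y z : y \notin V -> z \notin V -> y |: V = z |: V -> y = z.
  move=> yV zV yz; have := setU11 y V; rewrite yz !inE (negPf yV) orbF.
  exact: eqP.
have aboveE k : [exists y, above m k y] = [exists y, top m k y].
  apply/existsP/existsP => -[y]; last by case/andP; exists y.
  exact: top_exists.
have nji : j != i by rewrite eq_sym.
rewrite !aboveE.
case: existsP => [[y ty]|Ni]; case: existsP => [[z tz]|Nj] /=.
- have yV := topV _ _ _ nij mij ty; have zV := topV _ _ _ nji (esym mij) tz.
  have nyz : y != z.
    apply/eqP => yz; move: ty tz; rewrite -yz => /andP[ay _] /andP[az _].
    exact: (not_above_both domV mP nij ay az).
  have -> : rooms V = [set y |: V; z |: V].
    apply/setP => U; rewrite in_set2.
    apply/idP/pred2P => [/roomP[u [-> uV]]|[]->].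
    - by case=> tu; rewrite ?(top_uniq tu ty) ?(top_uniq tu tz); [left|right].
    - exact: top_room _ _ _ nij mij ty.
    - exact: top_room _ _ _ nji (esym mij) tz.
  by rewrite cards2; case: eqVneq => [/setU1V yz|//]; rewrite yz ?eqxx in nyz.
- suff -> : rooms V = [set y |: V] by rewrite cards1.
  apply/setP => U; rewrite in_set1; apply/idP/eqP => [/roomP[u [-> uV]]|->].
    by case=> tu; [rewrite (top_uniq tu ty)|case: Nj; exists u].
  exact: top_room _ _ _ nij mij ty.
- suff -> : rooms V = [set z |: V] by rewrite cards1.
  apply/setP => U; rewrite in_set1; apply/idP/eqP => [/roomP[u [-> uV]]|->].
    by case=> tu; [case: Ni; exists u|rewrite (top_uniq tu tz)].
  exact: top_room _ _ _ nji (esym mij) tz.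
- suff -> : rooms V = set0 by rewrite cards0.
  apply/setP => U; rewrite in_set0; apply/negP => /roomP[u [_ _]].
  by case=> tu; [apply: Ni|apply: Nj]; exists u.
Qed.

End Dominance.

(* The slacks let a subset of Y encode both a set of points and a set of
   indices: the indices whose slack is missing. *)
Section Scarf.
Variables (Y I : finType) (rk : I -> Y -> nat) (slack : I -> Y) (c : Y -> I).
Variable x0 : Y.
Hypothesis rk_inj : forall j, injective (rk j).
Hypothesis I_gt1 : 1 < #|I|.
Hypothesis slack_low : forall j y, rk j (slack j) <= rk j y.
Hypothesis slack_high : forall i j y,
  i != j -> y \notin codom slack -> rk j y < rk j (slack i).
Hypothesis c_slack : forall i, c (slack i) = i.
Hypothesis x0P : x0 \notin codom slack.
Implicit Types (U V : {set Y}) (i j k l : I) (y z : Y).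

Let slack_inj : injective slack. Proof. exact: can_inj c_slack. Qed.

(** Because of y, [slack k] can be a minimum for no index but k. Hence [slack k] is a candidate for
    each k, and a dominant V lies in exactly two rooms. *)
Lemma even_interior_rooms V y : y \in V -> y \notin codom slack ->
  #|V|.+1 = #|I| -> ~~ odd #|rooms rk V|.
Proof.
move=> yV yX cV; have [domV|ndV] := boolP (dominant rk V); last first.
  suff -> : rooms rk V = set0 by rewrite cards0.
  apply/setP => U; rewrite !inE; apply: contraNF ndV => /and3P[sVU _].
  exact: dominantS.
have V0 : V != set0 by apply/set0Pn; exists y.
have [m mP] := min_exists rk V0.
have [i [j [nij mij]]] := min_collision cV mP.
have m_low l : m l \notin codom slack \/ m l = slack l.
  have [/codomP[k mE]|] := boolP (m l \in codom slack); last by left.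
  right; have [kl|nkl] := eqVneq k l; first by rewrite mE kl.
  have /is_minP[_ /(_ _ yV)] := mP l.
  by rewrite mE leqNgt slack_high.
have ab k : [exists z, above rk m k z].
  apply/existsP; exists (slack k); apply/forall_inP => l nlk.
  have [mX|->] := m_low l; first by rewrite slack_high // eq_sym.
  rewrite ltn_neqAle slack_low andbT (inj_eq (@rk_inj l)).
  by rewrite (inj_eq slack_inj).
by rewrite (odd_rooms rk_inj domV cV mP nij mij) !ab.
Qed.

(** Here [m l] is [slack l] for l other than i0, and i0 shares its minimum with some l0. The point
    x0 is a candidate for i0, but l0 has none. *)
Lemma odd_boundary_rooms i0 : odd #|rooms rk (slack @: [set~ i0])|.
Proof.
set V := slack @: _.
have VP l : (slack l \in V) = (l != i0).
  by rewrite mem_imset // !inE.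
have cV : #|V|.+1 = #|I|.
  by rewrite card_imset // cardsC1 prednK // ltnW.
have V0 : V != set0.
  by rewrite -card_gt0 -ltnS cV.
have domV : dominant rk V.
  apply/dominantP => y.
  have [/codomP[l ->]|yX] := boolP (y \in codom slack).
    by exists l => u _; apply: slack_low.
  exists i0 => _ /imsetP[l + ->]; rewrite !inE => nl.
  by rewrite ltnW // slack_high.
have [m mP] := min_exists rk V0.
have mE l : l != i0 -> m l = slack l.
  move=> nl; apply: (is_min_uniq rk_inj (mP l)); apply/is_minP.
  by rewrite VP.
have [l0 nl0 ml0] : exists2 l, l != i0 & m i0 = slack l.
  by have /is_minP[/imsetP[l + ml] _] := mP i0; rewrite !inE => ?; exists l.
have nil : i0 != l0 by rewrite eq_sym.
rewrite (odd_rooms rk_inj domV cV mP nil) ?ml0 ?mE //.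
have -> : [exists y, above rk m i0 y].
  apply/existsP; exists x0; apply/forall_inP => l nl; rewrite mE //.
  rewrite ltn_neqAle slack_low andbT (inj_eq (@rk_inj l)) eq_sym.
  by apply: contra x0P => /eqP->; apply: codom_f.
suff /negPf-> : ~~ [exists y, above rk m l0 y] by [].
(* A candidate for l0 exceeds [slack l0] in the order i0, so it is a slack, neither that of i0 nor
   that of l0; but any other slack is the bottom of its own order. *)
apply/existsPn => y; apply/negP => /forall_inP ay.
have := ay _ nil; rewrite ml0.
have [/codomP[l yE]|yX] := boolP (y \in codom slack); last first.
  by rewrite ltnNge ltnW // slack_high.
rewrite yE; have [->|nli] := eqVneq l i0; first by rewrite ltnNge slack_low.
have [->|nll] := eqVneq l l0; first by rewrite ltnn.
by move=> _; have := ay _ nll; rewrite mE // yE ltnn.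
Qed.

Definition labelled_door i0 V := (#|V|.+1 == #|I|) && (c @: V == [set~ i0]).

(** A door in U omits one element u and carries each label but i0 once. As U misses a label, u
    repeats the label of exactly one v, so the only doors are U without u and U without v. *)
Lemma even_labelled_doors i0 U : #|U| = #|I| -> c @: U != setT ->
  ~~ odd #|[set V : {set Y} | labelled_door i0 V & V \subset U]|.
Proof.
move=> cU ncU; set D := [set V : {set Y} | _ & _].
have doorP V : V \in D -> exists2 u, u \in U & V = U :\ u.
  rewrite !inE => /andP[/andP[/eqP cV _] sVU].
  have /eqP/cards1P[u Uu] : #|U :\: V| = 1.
    by rewrite cardsD (setIidPr sVU) cU -cV subSnn.
  exists u; first by have := set11 u; rewrite -Uu inE => /andP[].
  by rewrite -Uu setDDr setDv set0U (setIidPr sVU).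
have [->|[V VD]] := set_0Vmem D; first by rewrite cards0.
have [u uU VE] := doorP V VD.
move: (VD); rewrite inE => /andP[/andP[/eqP cV /eqP cVE] sVU].
have cinj : {in V &, injective c}.
  by apply/imset_injP; rewrite cVE cardsC1 -cV.
have cu : c u != i0.
  apply: contra ncU => /eqP cu; apply/eqP.
  rewrite -(setD1K uU) -VE imsetU1 cVE cu.
  by apply/setP => z; rewrite !inE orbN.
have [v vV cuv] : exists2 v, v \in V & c u = c v.
  by apply/imsetP; rewrite cVE !inE.
have vU : v \in U by apply: (subsetP sVU).
have uv : u != v by apply: contraTneq vV => <-; rewrite VE !inE eqxx.
suff -> : D = [set U :\ u; U :\ v].
  rewrite cards2; case: eqP => // /setP/(_ u).
  by rewrite !inE uU uv eqxx.
apply/setP => W; rewrite in_set2; apply/idP/pred2P => [WD|].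
  have [w wU WE] := doorP W WD.
  have [wu|wu] := eqVneq w u; first by left; rewrite WE wu.
  right; rewrite WE; suff -> : w = v by [].
  have wV : w \in V by rewrite VE !inE wu.
  apply/eqP; apply: contraTT WD => wv; rewrite !inE; apply/negP.
  case/andP => /andP[_ /eqP cW] _.
  have : c w \in c @: W by rewrite cW -cVE imset_f.
  case/imsetP => z zW cwz; move: (zW); rewrite WE !inE => /andP[zw zU].
  have [zu|zu] := eqVneq z u.
    by case/eqP: wv; apply: cinj => //; rewrite cwz zu.
  by case/eqP: zw; apply/esym/cinj => //; rewrite VE !inE zu.
case=> ->; first by rewrite -VE.
have cUv : #|U :\ v|.+1 = #|I| by rewrite -cU (cardsD1 v U) vU.
rewrite inE subsetDl /labelled_door cUv eqxx andbT /=.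
apply/eqP; rewrite -cVE; apply/setP => k; apply/imsetP/imsetP => -[w wW ->].
  have [->|wu] := eqVneq w u; first by exists v.
  by exists w => //; move: wW; rewrite VE !inE wu => /andP[].
have [->|wv] := eqVneq w v; first by exists u => //; rewrite !inE uv.
by exists w => //; rewrite !inE wv (subsetP sVU).
Qed.

(* Double counting modulo 2 of the pairs of a door labelled by all indices but
   i0 and a room containing it: only the door made of slacks lies in an odd
   number of rooms. *)
Lemma scarf : exists U, [/\ #|U| = #|I|, dominant rk U & c @: U = setT].
Proof.
have /card_gt0P[i0 _] := ltnW I_gt1.
pose room (U : {set Y}) := (#|U| == #|I|) && dominant rk U.
have [/existsP[U /and3P[/eqP cU dU /eqP cE]]|/existsPn none] :=
  boolP [exists U : {set Y}, [&& #|U| == #|I|, dominant rk U & c @: U == setT]].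
  by exists U.
have cardE (T : finType) (P : pred T) : #|[set V | P V]| = \sum_(V | P V) 1.
  by rewrite sum1dep_card.
have count : \sum_(V : {set Y} | labelled_door i0 V) #|rooms rk V| =
    \sum_(U : {set Y} | room U)
      #|[set V : {set Y} | labelled_door i0 V & V \subset U]|.
  transitivity (\sum_(V : {set Y} | labelled_door i0 V)
      \sum_(U : {set Y} | room U && (V \subset U)) 1).
    by apply: eq_bigr => V _; rewrite cardE; apply: eq_bigl => U; rewrite andbC.
  rewrite (exchange_big_dep room) /=; last by move=> V U _ /andP[].
  apply: eq_bigr => U roomU; rewrite cardE; apply: eq_bigl => V.
  by rewrite roomU.
have even_sum (T : finType) (P : pred T) (F : T -> nat) :
    (forall t, P t -> ~~ odd (F t)) -> ~~ odd (\sum_(t | P t) F t).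
  by move=> evF; elim/big_ind: _ => // a b; rewrite oddD => /negPf-> /negPf->.
have even_r : ~~ odd (\sum_(V : {set Y} | labelled_door i0 V) #|rooms rk V|).
  rewrite count; apply: even_sum => U /andP[/eqP cU domU].
  by apply: even_labelled_doors => //; have := none U; rewrite cU eqxx domU.
pose V0 := slack @: [set~ i0].
have gV0 : labelled_door i0 V0.
  rewrite /labelled_door card_imset // cardsC1 prednK 1?ltnW // eqxx /=.
  rewrite -imset_comp; apply/eqP; rewrite (eq_imset (g := id)) ?imset_id //.
case/negP: even_r; rewrite (bigD1 V0) //= oddD odd_boundary_rooms /=.
apply: even_sum => V /andP[/andP[/eqP cV /eqP cVE] nV].
(* A door made of slacks only and labelled by all indices but i0 is V0, so every other one contains
   a non-slack point. *)
have [/existsP[y /andP[yV yX]]|/existsPn noX] :=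
  boolP [exists y, (y \in V) && (y \notin codom slack)].
  exact: even_interior_rooms yV yX cV.
case/eqP: nV; apply/eqP; rewrite eqEcard; apply/andP; split.
  apply/subsetP => y yV; have := noX y; rewrite yV /= negbK => /codomP[l yE].
  by rewrite yE imset_f // -cVE; apply/imsetP; exists y; rewrite // yE c_slack.
by rewrite card_imset // cardsC1 -cV.
Qed.

End Scarf.

(** * Almost fully labelled points of the simplex *)

Section Grid.
Variables (I : finType) (N : nat).
Hypothesis I_gt1 : 1 < #|I|.

Definition grid := {w : {ffun I -> 'I_N.+1} | \sum_k w k == N}.
Definition grid_coord (w : grid) (k : I) : nat := sval w k.

Lemma coord_sum w : \sum_k grid_coord w k = N.
Proof. exact/eqP/(svalP w). Qed.

Lemma coord_le w k : grid_coord w k <= N.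
Proof. by have := ltn_ord (sval w k). Qed.

Lemma grid_point (f : I -> nat) : \sum_k f k = N -> exists w, grid_coord w =1 f.
Proof.
move=> fN; have fle k : f k < N.+1 by rewrite ltnS -fN (bigD1 k) //= leq_addr.
pose w := [ffun k => Ordinal (fle k)].
have wN : \sum_k w k == N.
  by rewrite -[X in _ == X]fN; apply/eqP/eq_bigr => k _; rewrite ffunE.
by exists (exist _ w wN) => k; rewrite /grid_coord /= ffunE.
Qed.

(* Coordinates are compared first; the enumeration only breaks ties. *)
Definition grid_rank (j : I) (y : grid + I) : nat :=
  match y with
  | inl w => (grid_coord w j * #|{: grid}| + enum_rank w).+1
  | inr i => if i == j then 0 else (N.+1 * #|{: grid}| + enum_rank i).+1
  end.

Lemma grid_rank_high j w (b : nat) :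
  grid_coord w j * #|{: grid}| + enum_rank w < N.+1 * #|{: grid}| + b.
Proof.
apply: (@leq_trans (N.+1 * #|{: grid}|)); last exact: leq_addr.
have : (grid_coord w j).+1 * #|{: grid}| <= N.+1 * #|{: grid}|.
  by rewrite leq_mul2r ltnS coord_le orbT.
by apply: leq_trans; rewrite mulSn addnC ltn_add2r ltn_ord.
Qed.

Lemma grid_rank_inj j : injective (grid_rank j).
Proof.
move=> [w|i] [w'|i'] /=.
- case=> /(congr1 (modn^~ #|{: grid}|)) /=.
  by rewrite !modnMDl !modn_small ?ltn_ord // => /val_inj/enum_rank_inj->.
- case: eqP => // _ [] E; have := grid_rank_high j w (enum_rank i').
  by rewrite E ltnn.
- case: eqP => // _ [] E; have := grid_rank_high j w' (enum_rank i).
  by rewrite -E ltnn.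
- case: eqP => [->|_]; case: eqP => [->|_] //.
  by case=> /addnI/val_inj/enum_rank_inj->.
Qed.

Lemma grid_rank_coord j w w' :
  grid_rank j (inl w) <= grid_rank j (inl w') ->
  grid_coord w j <= grid_coord w' j.
Proof.
rewrite /= ltnS; apply: contraTT; rewrite -!ltnNge => lt_w.
have : (grid_coord w' j).+1 * #|{: grid}| <= grid_coord w j * #|{: grid}|.
  by rewrite leq_mul2r lt_w orbT.
move=> le_w; apply: leq_trans (leq_trans le_w (leq_addr _ _)).
by rewrite mulSn addnC ltn_add2r ltn_ord.
Qed.

(** Scarf's lemma yields a set U. The labels in C, the indices whose slack is missing from U, come
    from grid points of U; dominance confines these points near the vector given by their minima on
    C and 0 off C. *)
Lemma grid_kkm (P : (I -> nat) -> pred I) :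
    (forall w, exists k, P (grid_coord w) k) ->
  exists w0 : grid, forall k, grid_coord w0 k <= #|I| \/
    exists2 w : grid, P (grid_coord w) k & forall l,
      (grid_coord w l <= grid_coord w0 l + #|I|) /\
      (grid_coord w0 l <= grid_coord w l + #|I|).
Proof.
move=> exP; pose lab y :=
  match y : grid + I with inl w => xchoose (exP w) | inr i => i end.
have codomE w : inl w \notin codom (@inr grid I) by apply/codomP => -[].
have /card_gt0P[k0 _] := ltnW I_gt1.
have [w1 _] : exists w, grid_coord w =1 (fun k => if k == k0 then N else 0).
  by apply: grid_point; rewrite -big_mkcond big_pred1_eq.
have [||//||U [cU /dominantP domU labU]] :=
    @scarf _ _ grid_rank inr lab (inl w1) grid_rank_inj I_gt1.
- by move=> j y /=; rewrite eqxx.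
- move=> i j [w|i'] nij; last by rewrite codom_f.
  by rewrite /= (negPf nij) ltnS grid_rank_high.
- exact: codomE.
pose C := [set k | inr k \notin U]; pose S := [set w | inl w \in U].
(* The slack of j is the bottom of the order j, strictly below w, so a witness of dominance at a
   grid point belongs to C. *)
have domS (w : grid) : exists2 j, j \in C &
    forall s, s \in S -> grid_coord w j <= grid_coord s j.
  have [j wj] := domU (inl w); exists j => [|s]; rewrite inE.
    by apply/negP => /wj; rewrite /= eqxx.
  by move/wj; apply: grid_rank_coord.
have [kC kCC _] := domS w1.
have [w0 w0S] : exists w, w \in S.
  have : kC \in lab @: U by rewrite labU.
  case/imsetP => -[w|i] wU kE; first by exists w; rewrite inE.
  by move: kCC; rewrite inE kE /= wU.
pose m k := grid_coord [arg min_(w < w0 in S) grid_coord w k] k.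
have m_le w k : w \in S -> m k <= grid_coord w k.
  by rewrite /m => wS; case: arg_minnP => // w' _; apply.
(* Otherwise some grid point would exceed all the minima indexed by C. *)
have m_sum : N < \sum_(k in C) (m k).+1.
  rewrite ltnNge; apply/negP => leN.
  pose f k := (if k \in C then (m k).+1 else 0) +
    if k == kC then N - \sum_(k in C) (m k).+1 else 0.
  have [w wf] : exists w, grid_coord w =1 f.
    apply: grid_point; rewrite big_split /= -!big_mkcond big_pred1_eq.
    by rewrite subnKC.
  have [j jC wj] := domS w.
  have : m j < grid_coord w j by rewrite wf /f jC leq_addr.
  by rewrite ltnNge /m; case: arg_minnP => // w' /wj->.
(* This bounds the total by which a point of S can exceed the minima. *)
have slackN : N - \sum_(k in C) m k <= #|I|.
  rewrite leq_subLR; apply: leq_trans (ltnW m_sum) _.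
  under eq_bigr do rewrite -addn1.
  by rewrite big_split /= leq_add2l sum1_card max_card.
have near w l : w \in S ->
    grid_coord w l <= (if l \in C then m l else 0) + #|I|.
  move=> wS; apply: leq_trans (leq_add (leqnn _) slackN).
  have := coord_sum w; rewrite (bigID (mem C)) /= => sum_w.
  have le_m : \sum_(k in C) m k <= \sum_(k in C) grid_coord w k.
    by apply: leq_sum => k _; apply: m_le.
  case: ifPn => lC.
    move: sum_w; rewrite !(bigD1 (P := fun k => k \in C) l lC) /=.
    have le_m' : \sum_(k in C | k != l) m k <=
        \sum_(k in C | k != l) grid_coord w k.
      by apply: leq_sum => k _; apply: m_le.
    have := m_le w l wS; lia.
  move: sum_w; rewrite [X in _ + X = _](bigD1 l) //=; lia.
exists w0 => k.
have [kU|kC'] := boolP (k \in C); last first.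
  by left; have := near w0 k w0S; rewrite (negPf kC').
right; have : k \in lab @: U by rewrite labU.
case/imsetP => -[w|i] wU kE; last by move: kU; rewrite inE kE /= wU.
have wS : w \in S by rewrite inE.
exists w => [|l]; first by rewrite kE; apply: (xchooseP (exP w)).
have near2 w' w'' : w' \in S -> w'' \in S ->
    grid_coord w' l <= grid_coord w'' l + #|I|.
  move=> w'S w''S; apply: leq_trans (near w' l w'S) _; rewrite leq_add2r.
  by case: ifP => // _; apply: m_le.
by split; apply: near2.
Qed.

End Grid.

Local Open Scope ring_scope.

Definition simplex (R : realType) (I : finType) (z : I -> R) : Prop :=
  (forall k, 0 <= z k) /\ \sum_k z k = 1.

(** Divide the grid by N, so that the error #|I| becomes #|I| / N. The labels obey no boundary
    condition; the price is that a coordinate may be nearly 0 instead of being a nearby label. *)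
Lemma simplex_kkm (R : realType) (I : finType) (P : (I -> R) -> pred I)
    (d : R) : (1 < #|I|)%N -> 0 < d ->
    (forall z, simplex z -> exists k, P z k) ->
  exists2 z0, simplex z0 & forall k, z0 k <= d \/
    exists z, [/\ simplex z, P z k & forall l, `|z l - z0 l| <= d].
Proof.
move=> I_gt1 d_gt0 exP; pose N := (Num.bound (#|I|%:R / d)).+1.
have N_gt0 : 0 < N%:R :> R by rewrite ltr0n.
have dN : #|I|%:R / N%:R <= d.
  rewrite ler_pdivrMr // mulrC -ler_pdivrMr //.
  apply: le_trans (ltW (archi_boundP _)) _; last by rewrite ler_nat.
  by rewrite divr_ge0 // ltW.
pose r (f : I -> nat) k : R := (f k)%:R / N%:R.
have r_simplex (w : grid I N) : simplex (r (grid_coord w)).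
  split=> [k|]; first by rewrite divr_ge0 // ltW.
  by rewrite -mulr_suml -natr_sum coord_sum divff // gt_eqF.
have [w0 w0P] := grid_kkm I_gt1 (P := P \o r) (fun w => exP _ (r_simplex w)).
exists (r (grid_coord w0)) => // k; case: (w0P k) => [le_w|[w wk near]].
  by left; apply: le_trans dN; rewrite ler_pM2r ?invr_gt0 // ler_nat.
right; exists (r (grid_coord w)); split=> // l; apply: le_trans dN.
rewrite -mulrBl normrM (gtr0_norm (x := N%:R^-1)) ?invr_gt0 //.
rewrite ler_pM2r ?invr_gt0 //; have [w_le w0_le] := near l.
by rewrite ler_distl lerBlDr -!natrD !ler_nat w0_le.
Qed.

(** * Lipschitz bounds for the payoffs *)

Section Tame.
Variables (R : realType) (n : nat) (S : 'I_n -> finType) (B : R).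
Implicit Types (f g : vec_profile R S -> R).

(** The bound is carried along with the Lipschitz estimate because the estimate for a product needs
    bounds on its factors. *)
Definition tame f := exists2 L : R, 0 <= L & forall d y y',
  (forall i s, `|y i s| <= B) -> (forall i s, `|y' i s| <= B) ->
  (forall i s, `|y i s - y' i s| <= d) -> 0 <= d ->
  `|f y| <= L /\ `|f y - f y'| <= L * d.

Lemma tame_cst (a : R) : tame (fun=> a).
Proof.
exists `|a| => // d y y' _ _ _ d_ge0; split=> //.
by rewrite subrr normr0 mulr_ge0.
Qed.

Lemma tame_coord i s : 0 <= B -> tame (fun y => y i s).
Proof.
move=> B_ge0; exists (B + 1); first by rewrite addr_ge0.
move=> d y y' yB y'B yy' d_ge0; split.
  by apply: le_trans (yB i s) _; rewrite lerDl.
by apply: le_trans (yy' i s) _; rewrite mulrDl mul1r lerDr mulr_ge0.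
Qed.

Lemma tameD f g : tame f -> tame g -> tame (fun y => f y + g y).
Proof.
move=> [L L0 fL] [M M0 gM]; exists (L + M); first exact: addr_ge0.
move=> d y y' yB y'B yy' d_ge0.
have [f1 f2] := fL d y y' yB y'B yy' d_ge0.
have [g1 g2] := gM d y y' yB y'B yy' d_ge0.
split; first exact: le_trans (ler_normD _ _) (lerD f1 g1).
by rewrite opprD addrACA mulrDl; apply: le_trans (ler_normD _ _) (lerD f2 g2).
Qed.

Lemma tameM f g : tame f -> tame g -> tame (fun y => f y * g y).
Proof.
move=> [L L0 fL] [M M0 gM]; exists (L * M + L * M).
  by rewrite addr_ge0 ?mulr_ge0.
move=> d y y' yB y'B yy' d_ge0.
have [f1 f2] := fL d y y' yB y'B yy' d_ge0.
have [g1 g2] := gM d y y' yB y'B yy' d_ge0.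
have d'_ge0 : forall i s, `|y' i s - y i s| <= d by move=> i s; rewrite distrC.
have [f3 _] := fL d y' y y'B yB d'_ge0 d_ge0.
split.
  apply: (@le_trans _ _ (L * M)); first by rewrite normrM ler_pM.
  by rewrite lerDl mulr_ge0.
have -> : f y * g y - f y' * g y' = (f y - f y') * g y + f y' * (g y - g y').
  by ring.
apply: le_trans (ler_normD _ _) _; rewrite !normrM mulrDl; apply: lerD.
  by rewrite mulrAC ler_pM.
by rewrite -mulrA ler_pM.
Qed.

Lemma tame_sum (J : finType) (F : J -> vec_profile R S -> R) :
  (forall j, tame (F j)) -> tame (fun y => \sum_j F j y).
Proof.
move=> tF; elim: (index_enum J) => [|j r IHr].
  have [L L0 HL] := tame_cst 0; exists L => // d y y' yB y'B yy' d_ge0.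
  by rewrite !big_nil; apply: (HL d y y').
have [L L0 HL] := tameD (tF j) IHr; exists L => // d y y' yB y'B yy' d_ge0.
by rewrite !big_cons; apply: (HL d y y').
Qed.

Lemma tame_prod (J : finType) (F : J -> vec_profile R S -> R) :
  (forall j, tame (F j)) -> tame (fun y => \prod_j F j y).
Proof.
move=> tF; elim: (index_enum J) => [|j r IHr].
  have [L L0 HL] := tame_cst 1; exists L => // d y y' yB y'B yy' d_ge0.
  by rewrite !big_nil; apply: (HL d y y').
have [L L0 HL] := tameM (tF j) IHr; exists L => // d y y' yB y'B yy' d_ge0.
by rewrite !big_cons; apply: (HL d y y').
Qed.

Lemma tame_pure_payoff (A : 'I_n -> pure_profile S -> R) i s :
  0 <= B -> tame (fun y => pure_payoff A y (i := i) s).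
Proof.
move=> B_ge0; apply: tame_sum => t; apply: tameM; first exact: tame_cst.
by apply: tame_prod => j; apply: tame_coord.
Qed.

Lemma pure_payoff_lipschitz (A : 'I_n -> pure_profile S -> R) : 0 <= B ->
  exists2 L : R, 0 <= L & forall d y y',
    (forall i s, `|y i s| <= B) -> (forall i s, `|y' i s| <= B) ->
    (forall i s, `|y i s - y' i s| <= d) -> 0 <= d ->
    forall i (s : S i), `|pure_payoff A y s| <= L /\
      `|pure_payoff A y s - pure_payoff A y' s| <= L * d.
Proof.
move=> B_ge0.
have /fin_all_exists2[L L0 HL] (k : {i : 'I_n & S i}) :=
  tame_pure_payoff A (tagged k) B_ge0.
exists (\sum_k L k); first exact: sumr_ge0.
move=> d y y' yB y'B yy' d_ge0 i s.
have [f1 f2] := HL (Tagged (fun i => S i) s) d y y' yB y'B yy' d_ge0.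
have leL : L (Tagged (fun i => S i) s) <= \sum_k L k.
  by rewrite (bigD1 (Tagged (fun i => S i) s)) //= lerDl sumr_ge0.
split; first exact: le_trans f1 leL.
by apply: le_trans f2 _; rewrite ler_wpM2r.
Qed.

End Tame.

(** * Games *)

Section Game.
Variables (R : realType) (n : nat) (S : 'I_n -> finType).
Variable A : 'I_n -> pure_profile S -> R.
Implicit Types (x : vec_profile R S) (p : 'I_n -> R).

Lemma objectiveE x p :
  objective A x p = \sum_i (expected_payoff A x i - p i).
Proof.
rewrite /objective big_split /= sumrN; congr (_ - _); apply: eq_bigr => i _.
rewrite /expected_payoff /pure_payoff.
under [RHS]eq_bigr do rewrite big_distrr /=.
rewrite pair_bigA /=; apply: eq_bigr => u _.
by rewrite mulrA (mulrC (x i u.1)).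
Qed.

(** With a = p i at a feasible point all terms of the right-hand sum are nonnegative, so the
    objective can be bounded term by term. *)
Lemma payoff_gap x i (a : R) : \sum_s x i s = 1 ->
  expected_payoff A x i - a = - \sum_s x i s * (a - pure_payoff A x s).
Proof.
move=> x1; rewrite -[a in LHS]mulr1 -x1 mulr_sumr /expected_payoff.
rewrite -sumrB -sumrN; apply: eq_bigr => s _; ring.
Qed.

Lemma feasible_payoff_le x p i : feasible A x p -> expected_payoff A x i <= p i.
Proof.
case=> xp x1 x01; rewrite -subr_le0 payoff_gap // oppr_le0.
by apply: sumr_ge0 => s _; rewrite mulr_ge0 ?subr_ge0 //; case/andP: (x01 i s).
Qed.

Lemma mixed_feasible x p : mixed_profile x ->
  (forall i (s : S i), pure_payoff A x s <= p i) -> feasible A x p.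
Proof.
move=> mx xp; split=> // i; first by case: (mx i).
move=> s; have [x0 x1] := mx i; rewrite x0 -x1 (bigD1 s) //= lerDl.
exact: sumr_ge0.
Qed.

(** The pure payoffs of i do not involve [x i], so they survive its deviation. *)
Lemma expected_payoff_dfwith x i (y : S i -> R) :
  expected_payoff A (dfwith x y) i = \sum_s y s * pure_payoff A x s.
Proof.
apply: eq_bigr => s _; rewrite dfwith_in; congr (_ * _).
apply: eq_bigr => t _; congr (_ * _); apply: eq_bigr => -[j ji] _.
by rewrite dfwith_out //= eq_sym.
Qed.

End Game.

(** * Approximate equilibria *)

Section Existence.
Variables (R : realType) (n : nat) (S : 'I_n -> finType).
Variable A : 'I_n -> pure_profile S -> R.
Hypothesis n_gt1 : (2 <= n)%N.
Hypothesis S_gt0 : forall i, (0 < #|S i|)%N.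

Let index := {i : 'I_n & S i}.
Let idx i (s : S i) : index := Tagged (fun i => S i) s.
Let mass (z : index -> R) i := \sum_s z (@idx i s).
Let scaled (z : index -> R) : vec_profile R S := fun i s => n%:R * z (@idx i s).

Let n_gt0 : 0 < n%:R :> R. Proof. by rewrite ltr0n ltnW. Qed.

Lemma best_reply (y : vec_profile R S) i :
  exists s : S i, forall t : S i, pure_payoff A y t <= pure_payoff A y s.
Proof.
have [s0 _] : exists s : S i, true by have /card_gt0P[s _] := S_gt0 i; exists s.
exists [arg max_(s > s0) pure_payoff A y (s : S i)]%O => t.
by case: arg_maxP => // s _; apply.
Qed.

Lemma sum_mass (z : index -> R) : simplex z -> \sum_i mass z i = 1.
Proof. by case=> _ <-; rewrite sig_big_dep /=; apply: eq_bigr => -[]. Qed.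

Lemma index_gt1 : (1 < #|{: index}|)%N.
Proof.
have [s0] := best_reply (fun _ _ => 0) (Ordinal (ltnW n_gt1)).
have [s1] := best_reply (fun _ _ => 0) (Ordinal n_gt1) => _ _.
by apply/card_gt1P; exists (idx s0), (idx s1); split=> //; apply/eqP => -[].
Qed.

Lemma card_strategies_le i : (#|S i| <= #|{: index}|)%N.
Proof.
apply: (leq_card (@idx i)) => s t /eqP.
by rewrite -tag_eqE /tag_eq eqxx /= tagged_asE => /eqP.
Qed.

Lemma simplex_le1 (I : finType) (z : I -> R) k : simplex z -> z k <= 1.
Proof. by case=> z0 <-; rewrite (bigD1 k) //= lerDl sumr_ge0. Qed.

Lemma scaled_bound z i (s : S i) : simplex z -> `|scaled z s| <= n%:R.
Proof.
move=> sz; have [z0 _] := sz.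
have le1 := simplex_le1 (idx s) sz.
by rewrite normrM (ger0_norm (z0 _)) gtr0_norm // ler_piMr // ltW.
Qed.

(** Here y is [scaled] of the nearby point labelled (i, s). The bound e / 2 leaves room for the
    later normalization, which divides by n times a mass known only to be at least 1/2. *)
Lemma approximate_balance (e : R) : 0 < e ->
  exists z, [/\ simplex z, forall i, `|n%:R * mass z i - 1| <= e &
    forall i (s : S i), n%:R * z (idx s) <= e / 2 \/
      exists2 y : vec_profile R S,
        forall t : S i, pure_payoff A y t <= pure_payoff A y s &
        forall j (t : S j), `|y j t| <= n%:R /\ `|y j t - scaled z t| <= e].
Proof.
move=> e_gt0; pose D : R := #|{: index}|%:R.
have D_ge1 : 1 <= D by rewrite ler1n ltnW // index_gt1.
have D_gt0 : 0 < D by apply: lt_le_trans D_ge1.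
have n_ge2 : 2 <= n%:R :> R by rewrite ler_nat.
(* With D the number of pairs (i, s), passing to a nearby point changes n times a mass by at most e
   / n, hence by at most e over all n players. *)
pose d := e / (n%:R * n%:R * D).
have d_gt0 : 0 < d by rewrite divr_gt0 ?mulr_gt0.
have dE : n%:R * (D * d) = e / n%:R.
  by rewrite /d; field; rewrite !gt_eqF.
have nd_le : n%:R * d <= e / 2.
  apply: (@le_trans _ _ (n%:R * (D * d))).
    by rewrite ler_pM2l // ler_peMl // ltW.
  by rewrite dE ler_pM2l // lef_pV2 ?posrE.
have e2_le : e / 2 <= e by lra.
pose P (z : index -> R) : pred index := fun k =>
  (n%:R * mass z (tag k) <= 1) &&
  [forall t : S (tag k),
     pure_payoff A (scaled z) t <= pure_payoff A (scaled z) (tagged k)].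
have exP z : simplex z -> exists k, P z k.
  move=> sz; have [/existsP[i le1]|/existsPn gt1] :=
    boolP [exists i, n%:R * mass z i <= 1].
    have [s sP] := best_reply (scaled z) i; exists (idx s).
    by apply/andP; split=> //; apply/forallP.
  have : \sum_(i < n) 1 < \sum_i n%:R * mass z i :> R.
    apply: ltr_sum => [|i _]; last by rewrite ltNge gt1.
    by apply/hasP; exists (Ordinal n_gt1); rewrite ?mem_index_enum.
  by rewrite -mulr_sumr sum_mass // sumr_const card_ord mulr1 ltxx.
have [z sz zP] := simplex_kkm index_gt1 d_gt0 exP.
have [z_ge0 _] := sz.
have sum_d i : \sum_(s : S i) d <= D * d.
  by rewrite sumr_const -mulr_natl ler_pM2r // ler_nat card_strategies_le.
have mass_le i : n%:R * mass z i <= 1 + e / n%:R.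
  rewrite -dE.
  (* A coordinate of i above d is the label of a nearby point, where i has mass at most 1/n;
     otherwise all coordinates of i are at most d. *)
  have [/existsP[s lt_d]|/existsPn small] := boolP [exists s, d < z (@idx i s)].
    case: (zP (idx s)) => [|[z' [_ /andP[/= mz' _] near]]].
      by rewrite leNgt lt_d.
    apply: le_trans (lerD mz' (lexx _)); rewrite -mulrDr ler_pM2l //.
    apply: le_trans (lerD (lexx _) (sum_d i)); rewrite -big_split /=.
    by apply: ler_sum => t _; have := near (idx t); rewrite ler_distl; lra.
  rewrite -[leLHS]add0r; apply: lerD => //; rewrite ler_pM2l //.
  apply: le_trans (sum_d i); apply: ler_sum => t _.
  by rewrite leNgt small.
exists z; split=> // i; last first.
  move=> s; case: (zP (idx s)) => [le_d|[z' [sz' /andP[_ /forallP best] near]]].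
    by left; apply: le_trans nd_le; rewrite ler_pM2l.
  right; exists (scaled z') => // j t; split; first exact: scaled_bound.
  rewrite -mulrBr normrM gtr0_norm //; apply: le_trans e2_le.
  by apply: le_trans nd_le; rewrite ler_pM2l.
have en_ge0 : 0 <= e / n%:R by rewrite divr_ge0 // ltW.
have en_le : e / n%:R <= e by rewrite ler_pdivrMr // ler_peMr ?ltW //; lra.
(* The masses are at most 1/n up to e and sum to 1, hence also at least 1/n. *)
have slack_sum : \sum_j (1 + e / n%:R - n%:R * mass z j) = e.
  rewrite sumrB -mulr_sumr sum_mass // sumr_const card_ord -mulr_natl.
  by field; rewrite gt_eqF.
have : 1 + e / n%:R - n%:R * mass z i <= e.
  rewrite -[leRHS]slack_sum (bigD1 i) //= lerDl.
  by apply: sumr_ge0 => j _; rewrite subr_ge0.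
by have := mass_le i; rewrite ler_distl; lra.
Qed.

(** Normalize the z of [approximate_balance] to x and let p be the best payoffs against x. Each
    weight times its gap is at most 4 L h: either the weight is small and the gap bounded, or the
    gap itself is small. *)
Lemma approximate_equilibrium (e : R) : 0 < e ->
  exists x p, feasible A x p /\ - e <= objective A x p.
Proof.
move=> e_gt0; have [L L_ge0 lip] := pure_payoff_lipschitz A (ltW n_gt0).
pose D : R := #|{: index}|%:R.
have DL_ge0 : 0 <= 4 * D * L by rewrite !mulr_ge0.
(* The bound 1/2 keeps n times each mass at least 1/2; the other makes the D products total at most
   e, and its + 1 keeps the denominator positive if L is 0. *)
pose h := Num.min (2^-1) (e / (4 * D * L + 1)).
have h_gt0 : 0 < h by rewrite lt_min invr_gt0 ltr0n divr_gt0 //; lra.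
have h_half : h <= 2^-1 by rewrite ge_min lexx.
have h_e : D * (4 * L * h) <= e.
  have : h <= e / (4 * D * L + 1) by rewrite ge_min lexx orbT.
  rewrite ler_pdivlMr; last by lra.
  nra.
have [z [sz massP zP]] := approximate_balance h_gt0.
have [z_ge0 _] := sz.
have mass_half i : 2^-1 <= n%:R * mass z i.
  by have := massP i; rewrite ler_distl; lra.
have mass_gt0 i : 0 < mass z i.
  rewrite -(pmulr_rgt0 _ n_gt0); apply: lt_le_trans (mass_half i).
  by rewrite invr_gt0.
pose x : vec_profile R S := fun i s => z (idx s) / mass z i.
have x_ge0 i s : 0 <= x i s by rewrite divr_ge0 // ltW.
have mx : mixed_profile x.
  by move=> i; split=> //; rewrite /x -mulr_suml -/(mass z i) divff // gt_eqF.
have x_le1 i s : x i s <= 1.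
  have [_ x1] := mx i; rewrite -x1 (bigD1 s) //= lerDl; exact: sumr_ge0.
have scaledE i (s : S i) : scaled z s = n%:R * mass z i * x i s.
  by rewrite /scaled /x; field; rewrite gt_eqF.
have x_scaled i (s : S i) : `|x i s - scaled z s| <= h.
  have -> : x i s - scaled z s = - (n%:R * mass z i - 1) * x i s.
    by rewrite scaledE; ring.
  rewrite normrM normrN (ger0_norm (x_ge0 i s)) -[leRHS]mulr1.
  by apply: ler_pM.
have x_bound i s : `|x i s| <= n%:R.
  by rewrite ger0_norm //; apply: le_trans (x_le1 i s) _; rewrite ler1n ltnW.
have /fin_all_exists[b bP] := best_reply x.
pose p i := pure_payoff A x (b i).
exists x, p; split; first exact: mixed_feasible.
have gap i s : x i s * (p i - pure_payoff A x s) <= 4 * L * h.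
  have gap_ge0 : 0 <= p i - pure_payoff A x s by rewrite subr_ge0.
  case: (zP i s) => [small|[y best near]].
    have x_small : x i s <= h.
      have := ler_wpM2r (x_ge0 i s) (mass_half i).
      by rewrite -scaledE /scaled; lra.
    have d0 i' (s' : S i') : `|x i' s' - x i' s'| <= 0 by rewrite subrr normr0.
    have [+ _] := lip 0 x x x_bound x_bound d0 (lexx _) i s.
    have [+ _] := lip 0 x x x_bound x_bound d0 (lexx _) i (b i).
    rewrite -/(p i) !ler_norml => /andP[_ p_le] /andP[x_le _].
    have gap_le : p i - pure_payoff A x s <= 4 * L by lra.
    by rewrite mulrC; apply: ler_pM.
  (* Now s is a best reply to y, within 2 h of x, so the payoffs of s and of [b i] each move by at
     most 2 L h. *)
  have y_bound j t : `|y j t| <= n%:R by have [] := near j t.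
  have xy j t : `|x j t - y j t| <= 2 * h.
    have [_] := near j t; have := x_scaled j t; rewrite !ler_distl; lra.
  have h2 : 0 <= 2 * h by lra.
  have [_ +] := lip _ x y x_bound y_bound xy h2 i s.
  have [_ +] := lip _ x y x_bound y_bound xy h2 i (b i).
  rewrite -/(p i) !ler_distl => /andP[_ p_le] /andP[x_le _].
  have := best (b i) => best_b.
  apply: le_trans (ler_piMl gap_ge0 (x_le1 i s)) _; lra.
rewrite objectiveE.
under eq_bigr => i _ do rewrite payoff_gap ?(proj2 (mx i)) //.
rewrite sumrN lerN2; apply: le_trans h_e.
rewrite sig_big_dep /= [leRHS]mulr_natl -sumr_const.
by apply: ler_sum => -[i s] _; apply: gap.
Qed.

End Existence.

Theorem theorem1 (R : realType) (n : nat) (hn : (2 <= n)%N)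
    (S : 'I_n -> finType) (hS : forall i : 'I_n, (0 < #|S i|)%N)
    (A : 'I_n -> pure_profile S -> R)
    (x : vec_profile R S) (hx : mixed_profile x) :
  nash_equilibrium A x <->
  exists p : 'I_n -> R, optimal_solution A x p.
Proof.
split=> [nash|[p [fx opt]]].
  exists (expected_payoff A x); split.
    apply: mixed_feasible => // i s.
    have := nash i (fun t => (t == s)%:R).
    rewrite expected_payoff_dfwith (bigD1 s) //= eqxx mul1r.
    rewrite big1 => [|t /negPf->].
      rewrite addr0; apply; split=> [t|]; first exact: ler0n.
      by rewrite (bigD1 s) //= eqxx big1 ?addr0 // => t /negPf->.
    by rewrite mul0r.
  move=> y q fy; rewrite !objectiveE [leRHS]big1 => [|i _]; last exact: subrr.
  by apply: sumr_le0 => i _; rewrite subr_le0 feasible_payoff_le.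
(* Feasible points of value at least -e exist for each e > 0, so the maximum is at least 0. *)
have obj_ge0 : 0 <= objective A x p.
  apply/ler_addgt0Pr => e e_gt0.
  have [y [q [fy obj_y]]] := approximate_equilibrium A hn hS e_gt0.
  by rewrite -lerBlDr sub0r; apply: le_trans obj_y (opt _ _ fy).
(* The objective is a sum of terms that are at most 0; a nonnegative total leaves none of them
   negative. *)
have payoffE i : p i <= expected_payoff A x i.
  rewrite -subr_ge0; apply: le_trans obj_ge0 _.
  rewrite objectiveE (bigD1 i) //= gerDl; apply: sumr_le0 => j _.
  by rewrite subr_le0 feasible_payoff_le.
move=> i y [y_ge0 y1]; rewrite expected_payoff_dfwith.
apply: le_trans (payoffE i); rewrite -[p i]mul1r -y1 mulr_suml.
by apply: ler_sum => s _; rewrite ler_wpM2l //; case: fx.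
Qed.
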